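(* Let $n\geq1$, $q\leq p<0$, $\lambda<0$ and $\alpha,\beta\in\mathbb{R}$ be such that $\frac1{p'}+\frac1q+\frac{\alpha+\beta+\lambda}{n}=0$, where $\frac1p+\frac1{p'}=1$ and $\frac1q+\frac1{q'}=1$. Suppose that one of the following conditions is satisfied: (a) $\beta>-\frac{n}{p'}$; (b) $\alpha>-\frac{n}{q}$. Then there is a constant $C>0$, independent of $f$ and $h$, such that for all non-negative functions $f\in L^{q'}(\mathbb{R}^n)$ and all non-negative $h$ with $0<\int_{\mathbb{R}^n}h^p(x)\,dx<\infty$, $$\int_{\mathbb{R}^n}\int_{\mathbb{R}^n}|x|_E^{\alpha}f(x)|x-y|_E^{\lambda}h(y)|y|_E^{\beta}\,dx\,dy\geq C\left(\int_{\mathbb{R}^n}f^{q'}(x)\,dx\right)^{\frac1{q'}}\left(\int_{\mathbb{R}^n}h^{p}(x)\,dx\right)^{\frac1p}.$$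
   Context: $|\cdot|_E$ is the Euclidean norm on $\mathbb{R}^n$. Since $p,q<0$, one has $p',q'\in(0,1)$; $f\in L^{q'}(\mathbb{R}^n)$ means that $f$ is measurable with $\int_{\mathbb{R}^n}|f|^{q'}dx<\infty$. Functions are measurable, and for $r<0$ the convention $0^{r}=+\infty$ is used. *)

(* Defs.v *)
From HB Require Import structures.
From mathcomp Require Import all_boot all_order all_algebra.
From mathcomp Require Import all_classical all_reals all_analysis.

Set Implicit Arguments.
Unset Strict Implicit.
Unset Printing Implicit Defensive.
Import Order.TTheory GRing.Theory Num.Theory.
Import numFieldNormedType.Exports.
Local Open Scope classical_set_scope.
Local Open Scope ring_scope.

Section product_step.
Local Open Scope ereal_scope.
Context {R : realType} (n : nat).
Notation T := (measurableTypeR R).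
Variable m : {sigma_finite_measure set (n.-tuple T) -> \bar R}.

Definition tuple_cons (z : T * n.-tuple T) : n.+1.-tuple T :=
  [the n.+1.-tuple T of z.1 :: z.2].

Lemma measurable_tuple_cons : measurable_fun setT tuple_cons.
Proof.
by apply: measurable_cons; [exact: measurable_fst|exact: measurable_snd].
Qed.

(* lebesgue_measure (x) m, transported along R * R^n ~ R^(n+1) *)
Definition product_step : set (n.+1.-tuple T) -> \bar R :=
  pushforward (@lebesgue_measure R \x m) tuple_cons.

Let product_step0 : product_step set0 = 0.
Proof. by rewrite /product_step /pushforward preimage_set0 measure0. Qed.

Let product_step_ge0 A : 0 <= product_step A.
Proof. exact: (measure_ge0 (@lebesgue_measure R \x m)). Qed.

Let product_step_sigma_additive : semi_sigma_additive product_step.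
Proof.
move=> F mF tF mUF; rewrite /product_step /pushforward preimage_bigcup.
apply: measure_semi_sigma_additive.
- by move=> k; rewrite -[X in measurable X]setTI; exact: measurable_tuple_cons.
- apply/trivIsetP => /= i j _ _ ij; rewrite -preimage_setI.
  by move/trivIsetP : tF => /(_ _ _ _ _ ij) ->//; rewrite preimage_set0.
- rewrite -preimage_bigcup -[X in measurable X]setTI.
  exact: measurable_tuple_cons.
Qed.

HB.instance Definition _ := isMeasure.Build _ _ _ product_step
  product_step0 product_step_ge0 product_step_sigma_additive.

Let product_step_sigma_finite : sigma_finite setT product_step.
Proof.
have /sigma_finiteP[F [TF ndF Foo]] := sigma_finiteT (@lebesgue_measure R).
have /sigma_finiteP[G [TG ndG Goo]] := sigma_finiteT m.
pose E k : set (n.+1.-tuple T) :=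
  [set t : n.+1.-tuple T | F k (thead t)] `&`
  [set t : n.+1.-tuple T | G k [tuple of behead t]].
exists E.
  apply/esym; rewrite -subTset => t _.
  have [i _ Fi] : (\bigcup_k F k) (thead t) by rewrite -TF.
  have [j _ Gj] : (\bigcup_k G k) [tuple of behead t] by rewrite -TG.
  exists (maxn i j) => //; split.
  - by have /subsetPset/(_ _ Fi) := ndF _ _ (leq_maxl i j).
  - by have /subsetPset/(_ _ Gj) := ndG _ _ (leq_maxr i j).
move=> k; have [mF Fk] := Foo k; have [mG Gk] := Goo k; split.
  apply: measurableI.
  - rewrite -[X in measurable X]setTI.
    exact: (measurable_tnth (ord0 : 'I_n.+1) measurableT mF).
  - rewrite -[X in measurable X]setTI.
    exact: (@measurable_behead _ T n measurableT _ mG).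
rewrite /product_step /pushforward.
have consK z : [tuple of behead (tuple_cons z)] = z.2 by exact: val_inj.
rewrite (_ : _ @^-1` _ = F k `*` G k); last first.
  by apply/seteqP; split => z; rewrite /E /preimage /= consK.
by rewrite product_measure1E// lte_mul_pinfty// ge0_fin_numE.
Qed.

HB.instance Definition _ := Measure_isSigmaFinite.Build _ _ _ product_step
  product_step_sigma_finite.

End product_step.

(* Lebesgue measure on the Borel sets of R^n: the n-fold product of the
   one-dimensional Lebesgue measure. *)
Fixpoint borel_lebesgue {R : realType} (n : nat) :
    {sigma_finite_measure set (n.-tuple (measurableTypeR R)) -> \bar R} :=
  match n with
  | 0 => dirac [tuple]
  | k.+1 => product_step (borel_lebesgue k)
  end.

(* R^n with the sigma-algebra of all Lebesgue measurable sets, that is, of the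
   Caratheodory measurable sets of the Lebesgue outer measure.  The underlying
   type is n.-tuple R. *)
Definition Rn (R : realType) (n : nat) : measurableType _ :=
  caratheodory_type (((@borel_lebesgue R n)^*)%mu).

Definition lebesgueRn (R : realType) (n : nat) :
    {measure set (Rn R n) -> \bar R} :=
  @completed_measure_extension _ _ _ (@borel_lebesgue R n).

Lemma measurable_box {R : realType} (n : nat)
    (A : 'I_n -> set (measurableTypeR R)) : (forall i, measurable (A i)) ->
  measurable [set x : n.-tuple (measurableTypeR R) | forall i, A i (tnth x i)].
Proof.
move=> mA.
rewrite (_ : [set _ | _] = \bigcap_(i in [set: 'I_n])
    ((fun x : n.-tuple (measurableTypeR R) => tnth x i) @^-1` A i)).
  apply: fin_bigcap_measurable => //= i _.
  rewrite -[X in measurable X]setTI.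
  exact: (measurable_tnth i measurableT (mA i)).
by apply/seteqP; split => x /= h; [move=> i _|move=> i]; exact: h.
Qed.

Lemma borel_lebesgue_box {R : realType} (n : nat)
    (A : 'I_n -> set (measurableTypeR R)) : (forall i, measurable (A i)) ->
  borel_lebesgue n
    [set x : n.-tuple (measurableTypeR R) | forall i, A i (tnth x i)] =
  (\prod_(i < n) lebesgue_measure (A i))%E.
Proof.
elim: n A => [|n IH] A mA.
  by rewrite big_ord0 /= diracE mem_set// => -[].
rewrite big_ord_recl -IH//= -product_measure1E//; last first.
  exact: measurable_box (fun i => mA (lift ord0 i)).
rewrite /product_step /pushforward; congr (_ _).
apply/seteqP; split => -[a b] /=.
  move=> h; split; first exact: (h ord0).
  by move=> i; have := h (lift ord0 i); rewrite tnthS.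
move=> [Aa Ab] i; case: (unliftP ord0 i) => [j ->|->//].
by rewrite tnthS.
Qed.

Lemma lebesgueRn_box {R : realType} (n : nat) (a b : 'I_n -> R) :
  (forall i, a i <= b i) ->
  lebesgueRn R n [set x : n.-tuple R | forall i, a i <= tnth x i <= b i] =
  (\prod_(i < n) (b i - a i))%:E.
Proof.
move=> ab; pose A i : set (measurableTypeR R) := `[a i, b i]%classic.
have mA i : measurable (A i) by exact: measurable_itv.
rewrite (_ : [set _ | _] =
    [set x : n.-tuple (measurableTypeR R) | forall i, A i (tnth x i)]); last first.
  by apply/seteqP; split => x /= h i; have := h i; rewrite /A /= in_itv.
transitivity (borel_lebesgue n
    [set x : n.-tuple (measurableTypeR R) | forall i, A i (tnth x i)]).
  exact: (measurable_mu_extE (borel_lebesgue n) (measurable_box mA)).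
rewrite borel_lebesgue_box// -prodEFin; apply: eq_bigr => i _.
rewrite lebesgue_measure_itv/= lte_fin EFinB.
by case: ltP => // /(conj (ab i))/andP/le_anti ->; rewrite -EFinB subrr.
Qed.

Section functions.
Context {R : realType}.

Definition enorm (n : nat) (x : n.-tuple R) : R :=
  Num.sqrt (\sum_(i < n) tnth x i ^+ 2).

Definition tsub (n : nat) (x y : n.-tuple R) : n.-tuple R :=
  [tuple tnth x i - tnth y i | i < n].

(* a ^ r for a >= 0, with 0 ^ r = +oo when r < 0; the library's powR has
   0 `^ r = 0 there. *)
Definition epow (a r : R) : \bar R :=
  if (a == 0) && (r < 0) then +oo%E else (a `^ r)%:E.

(* f \in L^r(R^n), also for 0 < r < 1, which the library's Lfun excludes. *)
Definition inLr (n : nat) (r : R) (f : Rn R n -> R) : Prop :=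
  measurable_fun setT f /\
  (\int[lebesgueRn R n]_x epow `|f x| r < +oo)%E.

End functions.

(* Main.v *)
Require Import Defs.
From HB Require Import structures.
From mathcomp Require Import all_boot all_order all_algebra.
From mathcomp Require Import all_classical all_reals all_analysis.
From mathcomp Require Import measurable_realfun.
From mathcomp Require Import ring lra.

Import Order.TTheory GRing.Theory Num.Theory.
Import numFieldNormedType.Exports.
Local Open Scope classical_set_scope.
Local Open Scope ring_scope.

(* Split R^n into the dyadic annuli A_k = {2^k <= |x| < 2^(k+1)} and keep only
   the blocks A_k x A_k of the double integral.  There |x - y| <= 4 * 2^k, so as
   lambda < 0 the kernel is at least c * 2^(k(alpha+beta+lambda)), and the block
   is at least this times (\int_(A_k) f) (\int_(A_k) h).  The reverse Hölder
   inequality bounds these factors below by |A_k|^(1/q) a_k^(1/q') and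
   |A_k|^(1/p') b_k^(1/p), where a_k and b_k are the integrals of f^q' and h^p
   over A_k; by the balance condition all powers of 2^k cancel.  Finally
   b_k^(1/p) >= B^(1/p-1/q) b_k^(1/q) with B = \sum_k b_k, because q <= p < 0,
   and the reverse Hölder inequality for series gives
   \sum_k a_k^(1/q') b_k^(1/q) >= (\sum_k a_k)^(1/q') B^(1/q). *)

(** * Reverse Hölder inequalities *)

(* Unlike in [ge0_le_integral], [g] need not be measurable: below it is the
   inner integral of a double integral. *)
Lemma le_integral_ge0 {d : measure_display} {T : measurableType d}
    {R : realType} (mu : {measure set T -> \bar R}) (D : set T)
    (f g : T -> \bar R) :
  (forall x, D x -> 0 <= f x)%E -> (forall x, D x -> f x <= g x)%E ->
  (\int[mu]_(x in D) f x <= \int[mu]_(x in D) g x)%E.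
Proof.
move=> f0 fg.
have g0 x : D x -> (0 <= g x)%E.
  by move=> Dx; exact: le_trans (f0 _ Dx) (fg _ Dx).
rewrite !ge0_integralE//; apply: ereal_sup_le => _ [s sf <-].
by exists s => // x; apply: le_trans (sf x) (lee_restrict fg x).
Qed.

(** Young's inequality with exponents [s] and [s/(s-1)], applied to [u v^((1-s)/s)] and
    [v^((s-1)/s)], whose product is [u], then multiplied by [s]. *)
Lemma young_reverse {R : realType} (s u v : R) : 1 < s -> 0 <= u -> 0 < v ->
  s * u <= u `^ s * v `^ (1 - s) + (s - 1) * v.
Proof.
move=> s1 u0 v0; have s0 : 0 < s by lra.
have t0 : 0 < s / (s - 1) by apply: divr_gt0 => //; lra.
have := @conjugate_powR R (u * v `^ ((1 - s) / s)) (v `^ ((s - 1) / s)) s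
  (s / (s - 1)) (mulr_ge0 u0 (powR_ge0 _ _)) (powR_ge0 _ _) s0 t0.
rewrite powRM ?powR_ge0// -!powRrM -mulrA -powRD; last first.
  by rewrite (gt_eqF v0) implybT.
have -> : (1 - s) / s + (s - 1) / s = 0 by field; rewrite gt_eqF.
have -> : (1 - s) / s * s = 1 - s by field; rewrite gt_eqF.
have -> : (s - 1) / s * (s / (s - 1)) = 1.
  by field; rewrite (gt_eqF s0) gt_eqF//; lra.
rewrite powRr0 powRr1 ?(ltW v0)// mulr1 => /(_ _)/wrap[].
  by rewrite invf_div; field; rewrite gt_eqF.
rewrite invf_div -(ler_pM2l s0) => /le_trans; apply.
by rewrite le_eqVlt; apply/orP; left; apply/eqP; field; rewrite gt_eqF.
Qed.

Lemma powR_div {R : realType} (u a s : R) : 0 <= u -> 0 < a ->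
  (u / a) `^ s = u `^ s / a `^ s.
Proof.
move=> u0 /ltW a0; rewrite powRM ?invr_ge0//; congr (_ * _).
by rewrite -powR_inv1// powRAC powR_inv1// powR_ge0.
Qed.

(* The case [b = 0] is harmless since [0 `^ (1 - s) = 0].  Otherwise integrate
   the reverse Young inequality for [u / a] and [v / b]. *)
Lemma hoelder_reverse {d : measure_display} {T : measurableType d}
    {R : realType} (mu : {measure set T -> \bar R}) (D : set T)
    (u v : T -> R) (s a b : R) :
  measurable D -> measurable_fun D u -> measurable_fun D v -> 1 < s ->
  (forall x, D x -> 0 <= u x) -> (forall x, D x -> 0 < v x) ->
  (\int[mu]_(x in D) (u x)%:E = a%:E)%E ->
  (\int[mu]_(x in D) (v x)%:E = b%:E)%E ->
  ((a `^ s * b `^ (1 - s))%:E <=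
     \int[mu]_(x in D) (u x `^ s * v x `^ (1 - s))%:E)%E.
Proof.
move=> mD mu_ mv s1 u0 v0 ua vb.
have w0 x : D x -> (0 <= (u x `^ s * v x `^ (1 - s))%:E)%E.
  by move=> _; rewrite lee_fin mulr_ge0// powR_ge0.
have mw : measurable_fun D (EFin \o (fun x => u x `^ s * v x `^ (1 - s))).
  apply/measurable_EFinP; apply: measurable_funM.
    exact: (measurableT_comp (@measurable_powR R s) mu_).
  exact: (measurableT_comp (@measurable_powR R (1 - s)) mv).
have a0 : 0 <= a.
  by rewrite -lee_fin -ua; apply: integral_ge0 => x /u0; rewrite lee_fin.
have b0 : 0 <= b.
  by rewrite -lee_fin -vb; apply: integral_ge0 => x /v0 /ltW; rewrite lee_fin.
have [a_eq0|a_neq0] := eqVneq a 0.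
  by rewrite a_eq0 powR0 ?mul0r; [exact: integral_ge0|lra].
have [b_eq0|b_neq0] := eqVneq b 0.
  by rewrite b_eq0 powR0 ?mulr0; [exact: integral_ge0|lra].
have {a_neq0}a0 : 0 < a by rewrite lt_neqAle eq_sym a_neq0.
have {b_neq0}b0 : 0 < b by rewrite lt_neqAle eq_sym b_neq0.
(* [k] is the bound sought. As [(u/a)^s (v/b)^(1-s) = k^-1 u^s v^(1-s)], integrating Young's
   inequality gives [s <= k^-1 I + (s-1)], that is [k <= I], for the integral [I] on the right. *)
set k := a `^ s * b `^ (1 - s).
have k0 : 0 < k by rewrite mulr_gt0// powR_gt0.
have uvw x : D x -> ((s / a)%:E * (u x)%:E <=
    (k^-1)%:E * (u x `^ s * v x `^ (1 - s))%:E + ((s - 1) / b)%:E * (v x)%:E)%E.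
  move=> Dx; rewrite -!EFinM -EFinD lee_fin.
  have := @young_reverse R s (u x / a) (v x / b) s1
    (divr_ge0 (u0 _ Dx) (ltW a0)) (divr_gt0 (v0 _ Dx) b0).
  rewrite !powR_div ?(u0 _ Dx)// ?(ltW (v0 _ Dx))// mulrA mulrAC.
  move=> /le_trans; apply; rewrite /k invfM le_eqVlt.
  by apply/orP; left; apply/eqP; ring.
have : (\int[mu]_(x in D) ((s / a)%:E * (u x)%:E) <=
    \int[mu]_(x in D) ((k^-1)%:E * (u x `^ s * v x `^ (1 - s))%:E +
       ((s - 1) / b)%:E * (v x)%:E))%E.
  apply: le_integral_ge0 => // x Dx.
  by rewrite -EFinM lee_fin mulr_ge0 ?u0// divr_ge0// ltW//; lra.
have mue : measurable_fun D (EFin \o u) by exact/measurable_EFinP.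
have mve : measurable_fun D (EFin \o v) by exact/measurable_EFinP.
have k0' : 0 <= k^-1 by rewrite invr_ge0 ltW.
have sa0 : 0 <= s / a by rewrite divr_ge0 ?ltW//; lra.
have sb0 : 0 <= (s - 1) / b by rewrite divr_ge0 ?ltW//; lra.
have v0' x : D x -> (0 <= (v x)%:E)%E by move=> /v0/ltW; rewrite lee_fin.
rewrite ge0_integralD//; first last.
- exact: measurable_funeM.
- by move=> x Dx; rewrite mule_ge0// v0'.
- exact: measurable_funeM.
- by move=> x Dx; rewrite mule_ge0// w0.
rewrite !ge0_integralZl_EFin// ua vb.
rewrite -!EFinM !divfK ?gt_eqF//.
move: (integral_ge0 mu w0).
case: (integral _ _ _) => [i||] //=; last by move=> *; rewrite leey.
rewrite !lee_fin => i0 h.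
have : 1 <= k^-1 * i by lra.
by rewrite ler_pdivlMl// mulr1.
Qed.
Lemma le_integralT_sub {d : measure_display} {T : measurableType d}
    {R : realType} (mu : {measure set T -> \bar R}) (D : set T)
    (f g : T -> \bar R) :
  (forall x, D x -> 0 <= f x <= g x)%E -> (forall x, 0 <= g x)%E ->
  (\int[mu]_(x in D) f x <= \int[mu]_x g x)%E.
Proof.
move=> fg g0; rewrite integral_mkcond; apply: le_integral_ge0 => x _.
  by apply: erestrict_ge0 => {}x /fg/andP[].
by rewrite /patch; case: ifPn => // /set_mem/fg/andP[].
Qed.

(** Take [u = g^(1/s)] and [v = 1], so that [u^s = g]. Used for [f] with [s = 1/q']. *)
Lemma hoelder_reverse_cstr {d : measure_display} {T : measurableType d}
    {R : realType} (mu : {measure set T -> \bar R}) (D : set T)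
    (g : T -> R) (s a m : R) :
  measurable D -> measurable_fun D g -> 1 < s -> (forall x, D x -> 0 <= g x) ->
  (\int[mu]_(x in D) (g x `^ s^-1)%:E = a%:E)%E -> (mu D = m%:E)%E ->
  ((a `^ s * m `^ (1 - s))%:E <= \int[mu]_(x in D) (g x)%:E)%E.
Proof.
move=> mD mg s1 g0 ga Dm.
have Dm1 : (\int[mu]_(x in D) (cst 1 x)%:E = m%:E)%E.
  by rewrite -Dm -[RHS]mul1e -integral_cst.
have := @hoelder_reverse _ T R mu D (fun x => g x `^ s^-1) (cst 1) s a m mD
  (measurableT_comp (@measurable_powR R s^-1) mg) (measurable_cst _) s1
  (fun x _ => powR_ge0 _ _) (fun _ _ => ltr01) ga.
move=> /(_ Dm1)/le_trans; apply; apply: le_integral_ge0.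
  by move=> x _; rewrite lee_fin mulr_ge0 ?powR_ge0.
move=> x Dx; rewrite powR1 mulr1 -powRrM mulVf ?powRr1 ?g0// gt_eqF//.
exact: lt_trans s1.
Qed.

(** Take [u = 1] and [v = g^(1/(1-s))], so that [v^(1-s) = g]. Used for [h] with [s = 1/p'], where
    [1 - s = 1/p]. *)
Lemma hoelder_reverse_cstl {d : measure_display} {T : measurableType d}
    {R : realType} (mu : {measure set T -> \bar R}) (D : set T)
    (g : T -> R) (s b m : R) :
  measurable D -> measurable_fun D g -> 1 < s -> (forall x, D x -> 0 < g x) ->
  (\int[mu]_(x in D) (g x `^ (1 - s)^-1)%:E = b%:E)%E -> (mu D = m%:E)%E ->
  ((m `^ s * b `^ (1 - s))%:E <= \int[mu]_(x in D) (g x)%:E)%E.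
Proof.
move=> mD mg s1 g0 gb Dm.
have Dm1 : (\int[mu]_(x in D) (cst 1 x)%:E = m%:E)%E.
  by rewrite -Dm -[RHS]mul1e -integral_cst.
have := @hoelder_reverse _ T R mu D (cst 1)
  (fun x => g x `^ (1 - s)^-1) s m b mD
  (measurable_cst _) (measurableT_comp (@measurable_powR R (1 - s)^-1) mg) s1
  (fun _ _ => ler01) (fun x Dx => powR_gt0 _ (g0 x Dx)).
move=> /(_ Dm1 gb)/le_trans; apply; apply: le_integral_ge0.
  by move=> x _; rewrite lee_fin mulr_ge0 ?powR_ge0.
move=> x Dx; rewrite powR1 mul1r -powRrM mulVf ?powRr1 ?(ltW (g0 _ Dx))//.
by rewrite subr_eq0 lt_eqF.
Qed.

(** This is [hoelder_reverse] for the counting measure on [nat]. *)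
Lemma hoelder_reverse_series {R : realType} (u v : nat -> R) (s a b : R) :
  1 < s -> (forall k, 0 <= u k) -> (forall k, 0 < v k) ->
  (\sum_(k <oo) (u k)%:E = a%:E)%E -> (\sum_(k <oo) (v k)%:E = b%:E)%E ->
  ((a `^ s * b `^ (1 - s))%:E <= \sum_(k <oo) (u k `^ s * v k `^ (1 - s))%:E)%E.
Proof.
move=> s1 u0 v0 ua vb.
have H := @hoelder_reverse _ nat R counting setT u v s a b measurableT
  (fun _ _ _ => I) (fun _ _ _ => I) s1 (fun k _ => u0 k) (fun k _ => v0 k).
move: H; rewrite !ge0_integral_count => [|k|k|k];
  rewrite ?lee_fin ?u0 ?(ltW (v0 k))//.
  exact.
by rewrite mulr_ge0 ?powR_ge0.
Qed.

(** * Dyadic annuli *)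

(** The two occurrences of [measurable] refer to different sigma-algebras: the Borel sets, and the
    Caratheodory sets containing them. *)
Lemma measurable_Rn {R : realType} (n : nat)
    (A : set (n.-tuple (measurableTypeR R))) :
  measurable A -> measurable (A : set (Rn R n)).
Proof. by move=> mA; apply: sub_caratheodory; exact: sub_sigma_algebra. Qed.

Lemma measurable_enorm {R : realType} (n : nat) :
  measurable_fun [set: Rn R n] (@enorm R n : Rn R n -> R).
Proof.
have h : measurable_fun [set: n.-tuple (measurableTypeR R)]
    (fun x : n.-tuple (measurableTypeR R) =>
       (\sum_(i < n) tnth x i ^+ 2) : measurableTypeR R).
  apply: measurable_sum => i; apply: measurable_funX.
  exact: (measurable_tnth i).
move=> _ B mB; rewrite setTI; apply: measurable_Rn.
rewrite -[X in measurable X]setTI.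
(* The square root is handled as the power 1/2, with which it agrees on sums of squares. *)
have := measurableT_comp (@measurable_powR R 2^-1) h.
move=> /(_ measurableT B mB); congr (measurable (_ `&` _)).
apply/seteqP; split => x /=;
  by rewrite powR12_sqrt ?sumr_ge0// => i _; exact: sqr_ge0.
Qed.

Lemma ler_enorm_coord {R : realType} {n : nat} (x : n.-tuple R) (i : 'I_n) :
  `|tnth x i| <= enorm x.
Proof.
rewrite -sqrtr_sqr ler_wsqrtr// (bigD1 i)//= lerDl sumr_ge0// => j _.
exact: sqr_ge0.
Qed.

Lemma enorm_ge0 {R : realType} {n : nat} (x : n.-tuple R) : 0 <= enorm x.
Proof. exact: sqrtr_ge0. Qed.

Lemma sqr_enorm {R : realType} {n : nat} (x : n.-tuple R) :
  enorm x ^+ 2 = \sum_(i < n) tnth x i ^+ 2.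
Proof. by rewrite sqr_sqrtr// sumr_ge0// => i _; exact: sqr_ge0. Qed.

(** Instead of the triangle inequality, [|x-y|^2 <= 2|x|^2 + 2|y|^2 <= 4r^2]; the first bound is
    [(x_i + y_i)^2 >= 0] summed over coordinates. *)
Lemma enorm_tsub_le {R : realType} {n : nat} (x y : n.-tuple R) (r : R) :
  enorm x <= r -> enorm y <= r -> enorm (tsub x y) <= 2 * r.
Proof.
move=> xr yr; have r0 : 0 <= r := le_trans (enorm_ge0 x) xr.
rewrite -(@ler_pXn2r _ 2)// ?nnegrE ?enorm_ge0 ?mulr_ge0// sqr_enorm exprMn.
have : enorm x ^+ 2 <= r ^+ 2 by rewrite ler_pXn2r// nnegrE enorm_ge0.
have : enorm y ^+ 2 <= r ^+ 2 by rewrite ler_pXn2r// nnegrE enorm_ge0.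
have : \sum_(i < n) tnth (tsub x y) i ^+ 2 <=
    2 * (enorm x ^+ 2) + 2 * (enorm y ^+ 2).
  rewrite !sqr_enorm !mulr_sumr -big_split/=; apply: ler_sum => i _.
  rewrite tnth_mktuple; have := sqr_ge0 (tnth x i + tnth y i); nra.
lra.
Qed.

Definition annulus {R : realType} (n : nat) (r : R) : set (Rn R n) :=
  [set x | r <= enorm x < 2 * r].

Lemma measurable_annulus {R : realType} (n : nat) (r : R) :
  measurable (annulus n r).
Proof.
have -> : annulus n r = setT `&` @enorm R n @^-1` `[r, 2 * r[%classic.
  by rewrite setTI; apply/seteqP; split => x; rewrite /annulus /= in_itv.
exact: measurable_enorm.
Qed.

Lemma measurable_Rn_box {R : realType} (n : nat) (a b : 'I_n -> R) :
  measurable ([set x | forall i, a i <= tnth x i <= b i] : set (Rn R n)).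
Proof.
apply: measurable_Rn.
have := @measurable_box R n (fun i => `[a i, b i]%classic)
  (fun i => measurable_itv _).
congr measurable; apply/seteqP; split => x h i; have := h i;
by rewrite /= in_itv.
Qed.

(** The annulus lies in the cube [[-2r, 2r]^n]. *)
Lemma lebesgueRn_annulus_fin {R : realType} (n : nat) (r : R) : 0 < r ->
  (lebesgueRn R n (annulus n r) < +oo)%E.
Proof.
move=> r0; have r2 (i : 'I_n) : - (2 * r) <= 2 * r by lra.
apply: (@le_lt_trans _ _ (lebesgueRn R n
  [set x | forall i, - (2 * r) <= tnth x i <= 2 * r])); last first.
  by rewrite (lebesgueRn_box r2) ltry.
apply: le_measure; rewrite ?inE; [exact: measurable_annulus|
  exact: (@measurable_Rn_box R n (fun=> - (2 * r)) (fun=> 2 * r))|].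
move=> x /andP[_ /ltW xr] i.
by rewrite -ler_norml; exact: le_trans (ler_enorm_coord x i) xr.
Qed.

(** With [m = sqrt n], the annulus contains the cube [[r/m, 3r/(2m)]^n] of side [r/(2m)]: its points
    have norm between [r] and [3r/2 < 2r]. *)
Lemma lebesgueRn_annulus_ge {R : realType} (n : nat) (r : R) :
  (1 <= n)%N -> 0 < r ->
  (((2 * Num.sqrt n%:R)^-1 ^+ n * r ^+ n)%:E
     <= lebesgueRn R n (annulus n r))%E.
Proof.
move=> n1 r0; set m : R := Num.sqrt n%:R.
have m0 : 0 < m by rewrite sqrtr_gt0 ltr0n.
have r32 : 3 / 2 * r < 2 * r by lra.
have r32_ge0 : 0 <= 3 / 2 * r by lra.
have ab (i : 'I_n) : r / m <= 3 / 2 * r / m.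
  by rewrite ler_pM2r ?invr_gt0//; lra.
have -> : (2 * m)^-1 ^+ n * r ^+ n = \prod_(i < n) (3 / 2 * r / m - r / m).
  rewrite prodr_const card_ord -exprMn; congr (_ ^+ _).
  by field; rewrite gt_eqF.
rewrite -(lebesgueRn_box ab); apply: le_measure; rewrite ?inE;
  [exact: (@measurable_Rn_box R n (fun=> r / m) (fun=> 3 / 2 * r / m))|
   exact: measurable_annulus|].
have sum_cst (c : R) : 0 <= c ->
    Num.sqrt (\sum_(i < n) (c / m) ^+ 2) = c.
  move=> c0; rewrite sumr_const card_ord -[_ *+ n]mulr_natl exprMn exprVn.
  rewrite sqr_sqrtr ?ler0n// mulrCA mulfV ?mulr1 ?sqrtr_sqr ?ger0_norm//.
  by rewrite pnatr_eq0 -lt0n.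
have rm0 : 0 < r / m by rewrite divr_gt0.
move=> x /= xab; apply/andP; split.
  rewrite -[leLHS](sum_cst _ (ltW r0)) ler_wsqrtr// ler_sum// => i _.
  have /andP[xa _] := xab i.
  by rewrite ler_pXn2r// nnegrE ?(ltW rm0)// (le_trans (ltW rm0)).
apply: le_lt_trans r32; rewrite -[leRHS](sum_cst _ r32_ge0).
rewrite ler_wsqrtr// ler_sum// => i _; have /andP[xa xb] := xab i.
have x0 : 0 <= tnth x i by exact: le_trans (ltW rm0) xa.
by rewrite ler_pXn2r// nnegrE (le_trans x0).
Qed.

(** The set is the degenerate cube [{0}], of volume [0^n = 0] as [n >= 1]. *)
Lemma lebesgueRn_enorm0 {R : realType} (n : nat) : (1 <= n)%N ->
  lebesgueRn R n [set x | enorm x = 0] = 0%E.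
Proof.
move=> n1.
transitivity (lebesgueRn R n [set x | forall i, 0 <= tnth x i <= 0]);
    last first.
  rewrite (@lebesgueRn_box R n (fun=> 0) (fun=> 0))// subrr prodr_const.
  by rewrite card_ord expr0n gtn_eqF.
congr (lebesgueRn R n _); apply/seteqP; split => x /=.
  move=> x0 i; have := ler_enorm_coord x i.
  by rewrite x0 ler_norml oppr0.
move=> x0; rewrite /enorm big1 ?sqrtr0// => i _.
by rewrite (_ : tnth x i = 0) ?expr0n//; apply/eqP; rewrite eq_le andbC x0.
Qed.

(** Take logarithms to base 2. The floor form yields both the disjointness of the annuli and the
    covering. *)
Lemma dyadic_itvE {R : realType} (t : R) (z : int) : 0 < t ->
  (2 `^ z%:~R <= t < 2 * 2 `^ z%:~R) = (Num.floor (ln t / ln 2) == z).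
Proof.
move=> t0; have ln2 : 0 < ln 2 :> R by rewrite ln_gt0// ltr1n.
have z0 : 0 < 2 `^ z%:~R :> R by rewrite powR_gt0.
rewrite floor_eq ler_pdivlMr// ltr_pdivrMr// -!ln_powR intrD mulr1z.
rewrite powRD ?pnatr_eq0 ?implybT// powRr1// mulrC.
by rewrite ler_ln ?posrE// ltr_ln ?posrE ?mulr_gt0.
Qed.

(** Dyadic scales are indexed by integers, but countable unions and series by [nat]. Even numbers
    enumerate the nonnegative integers, odd ones the negative. *)
Lemma int_enum :
  exists2 s : nat -> int, injective s & forall z, exists k, s k = z.
Proof.
exists (fun k => if odd k then Negz k./2 else Posz k./2).
  move=> i j ij; rewrite -(odd_double_half i) -(odd_double_half j).
  by move: ij; case: (odd i); case: (odd j) => // -[->].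
case=> m; [exists m.*2|exists m.*2.+1].
  by rewrite odd_double doubleK.
by rewrite /= odd_double /= uphalf_double.
Qed.

Lemma dyadic_annuli (R : realType) (n : nat) : exists2 r : nat -> R,
  (forall k, 0 < r k) & trivIset setT (fun k => annulus n (r k)) /\
  \bigcup_k annulus n (r k) = [set x | enorm x != 0].
Proof.
have [s s_inj s_surj] := int_enum.
have r0 k : 0 < 2 `^ (s k)%:~R :> R by rewrite powR_gt0.
exists (fun k => 2 `^ (s k)%:~R) => //; split.
  move=> i j _ _ [x [xi xj]]; apply: s_inj; rewrite /annulus/= in xi xj.
  have x0 : 0 < enorm x by case/andP: xi => + _; exact: lt_le_trans.
  by move: xi xj; rewrite !dyadic_itvE// => /eqP <- /eqP.
apply/seteqP; split => x /=.
  by move=> [k _ /andP[xk _]]; rewrite gt_eqF// (lt_le_trans _ xk).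
move=> x0; have {}x0 : 0 < enorm x by rewrite lt_neqAle eq_sym x0 enorm_ge0.
have [k sk] := s_surj (Num.floor (ln (enorm x) / ln 2)).
by exists k => //; rewrite /annulus /= dyadic_itvE// sk.
Qed.

(** * Powers *)

Lemma ge_powR_npos {R : realType} (x y r : R) : 0 < x -> x <= y -> r <= 0 ->
  y `^ r <= x `^ r.
Proof.
move=> x0 xy r0; have y0 : 0 < y by exact: lt_le_trans xy.
rewrite -[r]opprK (powRN y) (powRN x) lef_pV2 ?posrE ?powR_gt0//.
by apply: ge0_ler_powR; rewrite ?nnegrE ?oppr_ge0// ltW.
Qed.

Lemma epow_ge0 {R : realType} (a r : R) : (0 <= epow a r)%E.
Proof. by rewrite /epow; case: ifP => // _; rewrite lee_fin powR_ge0. Qed.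

(** The power is at least [r^a] if [a >= 0] and at least [(2r)^a] if [a < 0]; the minimum covers
    both cases. *)
Lemma epow_ge {R : realType} (r t a : R) : 0 < r -> r <= t < 2 * r ->
  ((Num.min 1 (2 `^ a) * r `^ a)%:E <= epow t a)%E.
Proof.
move=> r0 /andP[rt t2r]; have t0 : 0 < t by exact: lt_le_trans rt.
rewrite /epow (gt_eqF t0)/= lee_fin; have [a0|a0] := leP 0 a.
  apply: (@le_trans _ _ (1 * r `^ a)).
    by rewrite ler_wpM2r ?powR_ge0// ge_min lexx.
  by rewrite mul1r ge0_ler_powR ?nnegrE ?(ltW r0) ?(ltW t0).
apply: (@le_trans _ _ (2 `^ a * r `^ a)).
  by rewrite ler_wpM2r ?powR_ge0// ge_min lexx orbT.
by rewrite -powRM ?(ltW r0)//; apply: ge_powR_npos => //; exact: ltW.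
Qed.

(** Here [|x-y| <= 4r] and a negative power reverses the order; for [x = y] the left-out value is
    [+oo], so the bound survives on the diagonal. *)
Lemma epow_tsub_ge {R : realType} {n : nat} (x y : n.-tuple R) (r l : R) :
  0 < r -> l < 0 -> enorm x <= 2 * r -> enorm y <= 2 * r ->
  ((4 `^ l * r `^ l)%:E <= epow (enorm (tsub x y)) l)%E.
Proof.
move=> r0 l0 xr yr; have := enorm_tsub_le x y (2 * r) xr yr.
rewrite /epow l0 andbT; case: eqVneq => [_ _|xy0 xyr]; first exact: leey.
rewrite lee_fin -powRM ?(ltW r0)//; apply: ge_powR_npos; last exact: ltW.
  by rewrite lt_neqAle eq_sym xy0 enorm_ge0.
by apply: le_trans xyr _; rewrite mulrA -natrM.
Qed.

Lemma measurable_epow {R : realType} (r : R) :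
  measurable_fun [set: R] (fun a => epow a r).
Proof.
rewrite /epow; case: (ltP r 0) => r0; last first.
  under eq_fun do rewrite andbF.
  by apply/measurable_EFinP; exact: measurable_powR.
under eq_fun do rewrite andbT.
apply: measurable_fun_ifT => //.
  exact: (measurable_fun_eqr (@measurable_id _ _ _) (measurable_cst _)).
by apply/measurable_EFinP; exact: measurable_powR.
Qed.

(** Where [h] vanishes, [epow (h x) p] is [+oo], so a finite integral forces that set to be null.
    This allows the zeros of [h] to be cut out of the annuli. *)
Lemma epow_pinfty_null {d : measure_display} {T : measurableType d}
    {R : realType} (mu : {measure set T -> \bar R}) (h : T -> R) (p : R) :
  measurable_fun setT h -> p < 0 -> (\int[mu]_x epow (h x) p < +oo)%E ->
  mu [set x | h x = 0] = 0%E.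
Proof.
move=> mh p0 hoo; set N := [set x | h x = 0].
have mN : measurable N.
  have := mh measurableT [set 0] (measurable_set1 0).
  by rewrite setTI.
have : (\int[mu]_(x in N) cst +oo x < +oo)%E.
  apply: le_lt_trans hoo; apply: le_integralT_sub => [x /= hx|x].
    by rewrite /epow hx eqxx p0/= leey lexx.
  exact: epow_ge0.
rewrite integral_cst//; have [//|N0] := eqVneq (mu N) 0%E.
by rewrite gt0_mulye ?ltxx// lt0e N0 measure_ge0.
Qed.

(** Multiply the lower bounds for the three powers; the exponents of [r] add up to
    [alpha + beta + lambda]. *)
Lemma kernel_ge {R : realType} {n : nat} (x y : n.-tuple R)
    (r alpha beta lambda s t : R) :
  0 < r -> lambda < 0 -> r <= enorm x < 2 * r -> r <= enorm y < 2 * r ->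
  0 <= s -> 0 <= t ->
  ((Num.min 1 (2 `^ alpha) * 4 `^ lambda * Num.min 1 (2 `^ beta) *
      r `^ (alpha + beta + lambda) * s * t)%:E <=
   epow (enorm x) alpha * s%:E * epow (enorm (tsub x y)) lambda * t%:E *
     epow (enorm y) beta)%E.
Proof.
move=> r0 l0 xr yr s0 t0.
have ge0 (a : R) : 0 <= Num.min 1 (2 `^ a) * r `^ a.
  by rewrite mulr_ge0 ?powR_ge0// le_min ler01 powR_ge0.
have -> : Num.min 1 (2 `^ alpha) * 4 `^ lambda * Num.min 1 (2 `^ beta) *
      r `^ (alpha + beta + lambda) * s * t =
    (Num.min 1 (2 `^ alpha) * r `^ alpha) * s * (4 `^ lambda * r `^ lambda) *
    t * (Num.min 1 (2 `^ beta) * r `^ beta).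
  by rewrite !powRD ?(gt_eqF r0) ?implybT//; ring.
have xy0 : 0 <= 4 `^ lambda * r `^ lambda by rewrite mulr_ge0 ?powR_ge0.
have [/ltW x2r /ltW y2r] : enorm x < 2 * r /\ enorm y < 2 * r.
  by case/andP: xr yr => _ ? /andP[].
have := epow_ge r (enorm x) alpha r0 xr.
have := epow_ge r (enorm y) beta r0 yr.
have := epow_tsub_ge x y r lambda r0 l0 x2r y2r.
move: (ge0 alpha) (ge0 beta) xy0.
set ka := _ * r `^ alpha; set kb := _ * r `^ beta; set kl := _ * r `^ lambda.
move=> ka0 kb0 kl0 kle kbe kae; rewrite !EFinM.
have kas0 : (0 <= ka%:E * s%:E)%E by rewrite -EFinM lee_fin mulr_ge0.
have kasl0 : (0 <= ka%:E * s%:E * kl%:E)%E by rewrite mule_ge0.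
have kaslt0 : (0 <= ka%:E * s%:E * kl%:E * t%:E)%E by rewrite mule_ge0.
have kbE0 : (0 <= kb%:E)%E by rewrite lee_fin.
have klE0 : (0 <= kl%:E)%E by rewrite lee_fin.
apply: (lee_pmul kaslt0 kbE0 _ kbe).
apply: lee_wpmul2r; first by rewrite lee_fin.
apply: (lee_pmul kas0 klE0 _ kle).
by apply: lee_wpmul2r; rewrite ?lee_fin.
Qed.

(** * Summation over blocks *)

(** For [y] in [E k], restricting [x] to [E k] bounds the inner integral below by [c k * F k * h y].
    These pieces form a measurable minorant [g] on the union of the blocks, integrated block by
    block. *)
Lemma le_double_integral_blocks {d : measure_display} {T : measurableType d}
    {R : realType} (mu : {measure set T -> \bar R}) (E : nat -> set T)
    (K : T -> T -> \bar R) (f h : T -> R) (c F H : nat -> R) :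
  (forall k, measurable (E k)) -> trivIset setT E ->
  measurable_fun setT f -> measurable_fun setT h ->
  (forall x, 0 <= f x) -> (forall x, 0 <= h x) ->
  (forall k, 0 <= c k) -> (forall k, 0 <= F k) -> (forall k, 0 <= H k) ->
  (forall x y, 0 <= K x y)%E ->
  (forall k x y, E k x -> E k y -> (c k * f x * h y)%:E <= K x y)%E ->
  (forall k, (F k)%:E <= \int[mu]_(x in E k) (f x)%:E)%E ->
  (forall k, (H k)%:E <= \int[mu]_(x in E k) (h x)%:E)%E ->
  (\sum_(k <oo) (c k * F k * H k)%:E <= \int[mu]_y \int[mu]_x K x y)%E.
Proof.
move=> mE tE mf mh f0 h0 c0 F0 H0 K0 EK Ff Hh.
(* The block containing [y]. The default 0 outside all blocks is harmless: [g] is integrated over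
   their union only. *)
pose idx y := xget 0%N [set k | E k y].
have idxE k y : E k y -> idx y = k.
  move=> Eky; have Eiy : E (idx y) y.
    by apply: (@xgetPex _ 0%N [set k | E k y]); exists k.
  by apply: tE => //; exists y.
pose g y := (c (idx y) * F (idx y) * h y)%:E.
have mfE k : measurable_fun (E k) (EFin \o f).
  by apply/measurable_EFinP; exact: measurable_funS mf.
have mhE k : measurable_fun (E k) (EFin \o h).
  by apply/measurable_EFinP; exact: measurable_funS mh.
have g0 y : (0 <= g y)%E by rewrite lee_fin !mulr_ge0.
have mg : measurable_fun (\bigcup_k E k) g.
  apply: (proj2 (measurable_fun_bigcup g mE)) => k.
  apply: (eq_measurable_fun (fun y => (c k * F k)%:E * (EFin \o h) y)%E).
    by move=> y /set_mem Eky; rewrite /g (idxE k)// EFinM.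
  exact: measurable_funeM.
have gK y : (\bigcup_k E k) y -> (g y <= \int[mu]_x K x y)%E.
  move=> [k _ Eky]; apply: (@le_trans _ _ (\int[mu]_(x in E k)
      ((c k * h y)%:E * (f x)%:E))%E).
    rewrite ge0_integralZl_EFin ?mulr_ge0//; last first.
      by move=> x _; rewrite lee_fin.
    rewrite /g (idxE k)// mulrAC EFinM lee_wpmul2l// lee_fin mulr_ge0//.
  apply: le_integralT_sub => // x Ekx; rewrite -EFinM lee_fin !mulr_ge0//=.
  by rewrite mulrAC EK.
apply: (@le_trans _ _ (\int[mu]_(y in \bigcup_k E k) g y)%E); last first.
  apply: le_integralT_sub => [y Ey|y]; first by rewrite g0 gK.
  exact: integral_ge0.
rewrite ge0_integral_bigcup//; apply: lee_nneseries => k _.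
  by rewrite lee_fin !mulr_ge0.
rewrite (eq_integral (fun y => (c k * F k)%:E * (h y)%:E)%E); last first.
  by move=> y /set_mem Eky; rewrite /g (idxE k)// EFinM.
rewrite ge0_integralZl_EFin ?mulr_ge0//; last by move=> x _; rewrite lee_fin.
by rewrite EFinM lee_wpmul2l// lee_fin mulr_ge0.
Qed.

(** A zero integral makes [g] vanish almost everywhere on [D]; as [g > 0] there, [D] lies in the
    exceptional null set. *)
Lemma integral_gt0_measure0 {d : measure_display} {T : measurableType d}
    {R : realType} (mu : {measure set T -> \bar R}) (D : set T) (g : T -> R) :
  measurable D -> measurable_fun D g -> (forall x, D x -> 0 < g x) ->
  (\int[mu]_(x in D) (g x)%:E = 0)%E -> mu D = 0%E.
Proof.
move=> mD mg g0 ig0.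
have mge : measurable_fun D (EFin \o g) by exact/measurable_EFinP.
have [+ _] := ae_eq_integral_abs mu mD mge.
case=> [|N [mN N0 DN]].
  rewrite -ig0; apply: eq_integral => x /set_mem Dx /=.
  by rewrite ger0_norm// ltW// g0.
apply/eqP; rewrite -measure_le0 -N0 le_measure ?inE// => x Dx.
apply: DN => /(_ Dx) /= [gx0]; have := g0 _ Dx.
by rewrite gx0 ltxx.
Qed.

Lemma ge0_ltey_EFin {R : realType} (x : \bar R) :
  (0 <= x < +oo)%E -> exists a, x = a%:E.
Proof. by case: x => [a _|/andP[_]|/andP[]] //; exists a. Qed.

(** Countable additivity, the complement being null. Finiteness of the total makes each piece a real
    number, as the reverse Hölder inequality for series requires. *)
Lemma integral_partition {d : measure_display} {T : measurableType d}
    {R : realType} (mu : {measure set T -> \bar R}) (E : nat -> set T)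
    (g : T -> \bar R) :
  (forall k, measurable (E k)) -> trivIset setT E ->
  mu (~` \bigcup_k E k) = 0%E ->
  measurable_fun setT g -> (forall x, 0 <= g x)%E -> (\int[mu]_x g x < +oo)%E ->
  exists2 a : nat -> R, (forall k, \int[mu]_(x in E k) g x = (a k)%:E)%E &
    (\sum_(k <oo) (a k)%:E = \int[mu]_x g x)%E.
Proof.
move=> mE tE E0 mg g0 goo.
have gE k : (\int[mu]_(x in E k) g x =
    (fine (\int[mu]_(x in E k) g x))%:E)%E.
  rewrite fineK// ge0_fin_numE ?integral_ge0//; apply: le_lt_trans goo.
  by apply: le_integralT_sub => // x _; rewrite g0 lexx.
exists (fun k => fine (\int[mu]_(x in E k) g x)) => //.
under eq_eseriesr do rewrite -gE.
have mU : measurable (\bigcup_k E k) by exact: bigcup_measurable.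
rewrite (@ge0_negligible_integral _ _ _ _ setT (~` \bigcup_k E k))//;
  last exact: measurableC.
by rewrite setDE setTI setCK ge0_integral_bigcup//; exact: measurable_funS mg.
Qed.

(* Used with [s = 1/q'], [x = w = 1/q], [y = 1/p'], [z = 1/p] and
   [g = alpha + beta + lambda]; [v] is the volume of the annulus. *)
Lemma block_bound {R : realType} (n : nat) (m c r v a b B s x y z w g : R) :
  0 < m -> 0 <= c -> 0 < r -> m * r ^+ n <= v -> 0 < b <= B ->
  0 <= x + y -> z <= w -> g + n%:R * (x + y) = 0 ->
  c * m `^ (x + y) * B `^ (z - w) * (a `^ s * b `^ w) <=
  c * r `^ g * (a `^ s * v `^ x) * (v `^ y * b `^ z).
Proof.
move=> m0 c0 r0 mv /andP[b0 bB] xy0 zw gxy.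
have mr0 : 0 < m * r ^+ n by rewrite mulr_gt0// exprn_gt0.
have v0 : 0 < v := lt_le_trans mr0 mv.
have -> : c * r `^ g * (a `^ s * v `^ x) * (v `^ y * b `^ z) =
    (c * a `^ s * b `^ w) * (r `^ g * v `^ (x + y) * b `^ (z - w)).
  rewrite -{1}(subrK w z) [b `^ (z - w + w)]powRD ?(gt_eqF b0) ?implybT//.
  by rewrite [v `^ (x + y)]powRD ?(gt_eqF v0) ?implybT//; ring.
rewrite (_ : _ * _ * _ * _ =
    (c * a `^ s * b `^ w) * (m `^ (x + y) * B `^ (z - w))); last by ring.
apply: ler_wpM2l; first by rewrite !mulr_ge0 ?powR_ge0.
(* Two factors remain: [B^(z-w) <= b^(z-w)] since [b <= B] and [z <= w], and
   [m^(x+y) <= r^g v^(x+y)]. *)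
apply: ler_pM; rewrite ?powR_ge0//; last first.
  by apply: ge_powR_npos => //; rewrite subr_le0.
(* Replacing [v] by [m r^n] produces [r^(g + n(x+y))], which is 1 by the balance condition. *)
apply: (@le_trans _ _ (r `^ g * (m * r ^+ n) `^ (x + y))).
  rewrite powRM ?exprn_ge0 ?(ltW r0) ?(ltW m0)// -powR_mulrn ?(ltW r0)//.
  rewrite -powRrM mulrCA -powRD ?(gt_eqF r0) ?implybT// gxy.
  by rewrite powRr0 mulr1.
apply: ler_wpM2l; first exact: powR_ge0.
by apply: ge0_ler_powR; rewrite ?nnegrE ?(ltW mr0) ?(ltW v0).
Qed.

(** The whole estimate for abstract blocks: the geometry enters through [mu (E k) >= m r_k^n] and
    the kernel bound on [E k] times [E k]. *)
Lemma double_integral_blocks_ge {d : measure_display} {T : measurableType d}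
    {R : realType} (mu : {measure set T -> \bar R}) (n : nat)
    (E : nat -> set T) (r : nat -> R) (K : T -> T -> \bar R) (f h : T -> R)
    (p q p' q' m c g : R) :
  q <= p -> p < 0 -> p^-1 + p'^-1 = 1 -> q^-1 + q'^-1 = 1 ->
  g + n%:R * (p'^-1 + q^-1) = 0 -> 0 < m -> 0 < c -> (forall k, 0 < r k) ->
  (forall k, measurable (E k)) -> trivIset setT E ->
  mu (~` (\bigcup_k E k)) = 0%E ->
  (forall k, (m * r k ^+ n)%:E <= mu (E k) < +oo)%E ->
  measurable_fun setT f -> measurable_fun setT h ->
  (forall x, 0 <= f x) -> (forall x, 0 <= h x) ->
  (forall k x, E k x -> 0 < h x) ->
  (\int[mu]_x epow (f x) q' < +oo)%E ->
  (0 < \int[mu]_x epow (h x) p < +oo)%E ->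
  (forall x y, 0 <= K x y)%E ->
  (forall k x y, E k x -> E k y ->
    (c * r k `^ g * f x * h y)%:E <= K x y)%E ->
  ((c * m `^ (p'^-1 + q^-1))%:E * (\int[mu]_x epow (f x) q') `^ q'^-1
     * (\int[mu]_x epow (h x) p) `^ p^-1 <= \int[mu]_y \int[mu]_x K x y)%E.
Proof.
move=> hqp hp hp' hq' hg m0 c0 r0 mE tE E_null mE_bnd mf mh f0 h0 hE foo.
move=> /andP[hB hBoo] K0 EK.
have pq : p^-1 <= q^-1 by rewrite lef_nV2 ?negrE// (le_lt_trans hqp).
have p0 : p^-1 < 0 by rewrite invr_lt0.
have q0 : q^-1 < 0 by rewrite invr_lt0 (le_lt_trans hqp).
(* These make [1/p'] and [1/q'] admissible as [s] in the reverse Hölder inequalities, with [1 - s]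
   equal to [1/p] and [1/q]. *)
have p'1 : 1 < p'^-1 by lra.
have q'1 : 1 < q'^-1 by lra.
have q'0 : 0 < q' by rewrite -invr_gt0; lra.
have pE : 1 - p'^-1 = p^-1 by lra.
have qE : 1 - q'^-1 = q^-1 by lra.
have xy0 : 0 <= q^-1 + p'^-1 by lra.
rewrite [p'^-1 + _]addrC in hg *.
have epowE (t s : R) : 0 < t -> epow t s = (t `^ s)%:E.
  by move=> t0; rewrite /epow gt_eqF.
have epowE' (t : R) : epow t q' = (t `^ q')%:E.
  by rewrite /epow ltNge (ltW q'0) andbF.
have mfq : measurable_fun setT (fun x => epow (f x) q').
  exact: (measurableT_comp (measurable_epow q') mf).
have mhp : measurable_fun setT (fun x => epow (h x) p).
  exact: (measurableT_comp (measurable_epow p) mh).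
have [A AE] : exists A, (\int[mu]_x epow (f x) q' = A%:E)%E.
  apply: ge0_ltey_EFin; rewrite foo andbT.
  by apply: integral_ge0 => x _; exact: epow_ge0.
have [B BE] : exists B, (\int[mu]_x epow (h x) p = B%:E)%E.
  by apply: ge0_ltey_EFin; rewrite hBoo andbT ltW.
have B0 : 0 < B by rewrite -lte_fin -BE.
have [a aE aA] := integral_partition mu E _ mE tE E_null mfq
  (fun=> epow_ge0 _ _) foo.
have [b bE bB] := integral_partition mu E _ mE tE E_null mhp
  (fun=> epow_ge0 _ _) hBoo.
rewrite AE in aA; rewrite BE in bB; rewrite AE BE.
pose v k := fine (mu (E k)).
have vE k : mu (E k) = (v k)%:E.
  by rewrite /v fineK// ge0_fin_numE//; case/andP: (mE_bnd k).
have v_ge k : m * r k ^+ n <= v k.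
  by rewrite -lee_fin -vE; case/andP: (mE_bnd k).
have afE k : (\int[mu]_(x in E k) (f x `^ q')%:E = (a k)%:E)%E.
  by rewrite -aE; apply: eq_integral => x _; rewrite epowE'.
have bhE k : (\int[mu]_(x in E k) (h x `^ p)%:E = (b k)%:E)%E.
  by rewrite -bE; apply: eq_integral => x /set_mem/hE/epowE ->.
have a0 k : 0 <= a k.
  by rewrite -lee_fin -aE; apply: integral_ge0 => x _; exact: epow_ge0.
have mfE k : measurable_fun (E k) f by exact: measurable_funS mf.
have mhE k : measurable_fun (E k) h by exact: measurable_funS mh.
(* If [b k] were 0, then [E k] would be null, against [mu (E k) >= m r_k^n > 0]. *)
have b0 k : 0 < b k.
  have : 0 <= b k.
    by rewrite -lee_fin -bE; apply: integral_ge0 => x _; exact: epow_ge0.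
  rewrite le_eqVlt => /predU1P[b0|//]; exfalso.
  have : mu (E k) = 0%E.
    apply: (integral_gt0_measure0 mu (E k) (fun x => h x `^ p)) => //.
    - exact: (measurableT_comp (@measurable_powR R p) (mhE k)).
    - by move=> x /hE; exact: powR_gt0.
    - by rewrite bhE -b0.
  rewrite vE => -[vk0]; have := v_ge k.
  by rewrite vk0 leNgt mulr_gt0// exprn_gt0.
have b_le k : 0 < b k <= B.
  rewrite b0 -lee_fin -bE -BE; apply: le_integralT_sub => x.
    by move=> _; rewrite epow_ge0 lexx.
  exact: epow_ge0.
have F_le k : ((a k `^ q'^-1 * v k `^ q^-1)%:E <=
    \int[mu]_(x in E k) (f x)%:E)%E.
  by rewrite -qE; apply: hoelder_reverse_cstr => //; rewrite invrK.
have H_le k : ((v k `^ p'^-1 * b k `^ p^-1)%:E <=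
    \int[mu]_(x in E k) (h x)%:E)%E.
  rewrite -{1}pE; apply: hoelder_reverse_cstl => //; first exact: hE.
  by rewrite pE invrK.
rewrite !poweR_EFin -!EFinM.
(* Reverse Hölder for series bounds this sum below by [A^(1/q') B^(1/q)] times the constant, and
   [B^(1/p-1/q) B^(1/q) = B^(1/p)]. *)
apply: (@le_trans _ _ (\sum_(k <oo) ((c * m `^ (q^-1 + p'^-1) *
    B `^ (p^-1 - q^-1)) * (a k `^ q'^-1 * b k `^ q^-1))%:E)%E).
  under eq_eseriesr do rewrite EFinM.
  rewrite nneseriesZl; last first.
    by move=> k _; rewrite lee_fin mulr_ge0 ?powR_ge0.
  have := hoelder_reverse_series a b q'^-1 A B q'1 a0 b0.
  rewrite qE => /(_ aA bB).
  have k0 : (0 <= (c * m `^ (q^-1 + p'^-1) * B `^ (p^-1 - q^-1))%:E)%E.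
    by rewrite lee_fin !mulr_ge0 ?powR_ge0 ?(ltW c0).
  move=> /(lee_wpmul2l k0); apply: le_trans; rewrite -EFinM lee_fin.
  rewrite -{1}(subrK q^-1 p^-1) [B `^ (_ + _)]powRD ?(gt_eqF B0) ?implybT//.
  by rewrite le_eqVlt; apply/orP; left; apply/eqP; ring.
(* Termwise comparison by [block_bound]; the new terms are kernel bound times the bounds for the
   integrals of [f] and [h] over [E k]. *)
apply: (@le_trans _ _ (\sum_(k <oo) (c * r k `^ g *
    (a k `^ q'^-1 * v k `^ q^-1) * (v k `^ p'^-1 * b k `^ p^-1))%:E)%E).
  apply: lee_nneseries => k _.
    by rewrite lee_fin !mulr_ge0 ?powR_ge0 ?(ltW c0).
  by rewrite lee_fin; apply: (@block_bound R n) => //; exact: ltW.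
apply: (le_double_integral_blocks mu E K f h (fun k => c * r k `^ g)
  (fun k => a k `^ q'^-1 * v k `^ q^-1)
  (fun k => v k `^ p'^-1 * b k `^ p^-1)) => // k.
- by rewrite mulr_ge0 ?powR_ge0 ?(ltW c0).
- by rewrite mulr_ge0 ?powR_ge0.
- by rewrite mulr_ge0 ?powR_ge0.
Qed.

(** * Application to the dyadic annuli of R^n *)

Theorem theorem3p7 (R : realType) (n : nat) (p q p' q' lambda alpha beta : R)
  (hn : (1 <= n)%N) (hqp : q <= p) (hp : p < 0) (hlambda : lambda < 0)
  (hp' : p^-1 + p'^-1 = 1) (hq' : q^-1 + q'^-1 = 1)
  (hbal : p'^-1 + q^-1 + (alpha + beta + lambda) / n%:R = 0)
  (hab : beta > - (n%:R / p') \/ alpha > - (n%:R / q)) :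
  exists C : R, 0 < C /\
    forall f h : Rn R n -> R,
      (forall x, 0 <= f x) -> inLr q' f ->
      (forall x, 0 <= h x) -> measurable_fun setT h ->
      (0 < \int[lebesgueRn R n]_x epow (h x) p < +oo)%E ->
      (\int[lebesgueRn R n]_y \int[lebesgueRn R n]_x
         (epow (enorm x) alpha * (f x)%:E * epow (enorm (tsub x y)) lambda
          * (h y)%:E * epow (enorm y) beta)
       >= C%:E * (\int[lebesgueRn R n]_x epow (f x) q') `^ q'^-1
          * (\int[lebesgueRn R n]_x epow (h x) p) `^ p^-1)%E.
Proof.
set mu := lebesgueRn R n.
have n0 : 0 < n%:R :> R by rewrite ltr0n.
set g := alpha + beta + lambda.
have hg : g + n%:R * (p'^-1 + q^-1) = 0.
  have gn : g / n%:R = - (p'^-1 + q^-1) by rewrite -/g in hbal; lra.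
  by rewrite -(divfK (lt0r_neq0 n0) g) gn mulrC mulrN addNr.
(* [m] is the volume constant of [lebesgueRn_annulus_ge]; [c] below is the constant of
   [kernel_ge]. *)
pose m : R := (2 * Num.sqrt n%:R)^-1 ^+ n.
have m0 : 0 < m by rewrite exprn_gt0// invr_gt0 mulr_gt0// sqrtr_gt0.
pose ca : R := Num.min 1 (2 `^ alpha).
pose cb : R := Num.min 1 (2 `^ beta).
have ca0 : 0 < ca by rewrite lt_min ltr01 powR_gt0.
have cb0 : 0 < cb by rewrite lt_min ltr01 powR_gt0.
pose c := ca * 4 `^ lambda * cb.
have c0 : 0 < c by rewrite !mulr_gt0// powR_gt0.
exists (c * m `^ (p'^-1 + q^-1)); split; first by rewrite mulr_gt0// powR_gt0.
move=> f h f0 [mf foo] h0 mh hB; have [_ hBoo] := andP hB.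
have [r r0 [tr Ur]] := dyadic_annuli R n.
pose N : set (Rn R n) := [set x | h x = 0].
have muN : mu N = 0%E by exact: (epow_pinfty_null mu h p).
have mN : measurable N.
  have := mh measurableT [set 0] (measurable_set1 0).
  by rewrite setTI.
(* Removing the null set [N] keeps the volumes and makes [h] positive on every block, as the reverse
   Hölder inequality requires. *)
pose E k := annulus n (r k) `\` N.
have mA k : measurable (annulus n (r k)) by exact: measurable_annulus.
have mE k : measurable (E k) by exact: measurableD.
have tE : trivIset setT E.
  move=> i j _ _ [x [[xi _] [xj _]]].
  exact: (tr i j I I (ex_intro _ x (conj xi xj))).
have muE k : mu (E k) = mu (annulus n (r k)).
  rewrite [RHS](measureDI mu (mA k) mN) -[LHS]adde0; congr (_ + _)%E.
  apply/esym/eqP; rewrite -measure_le0 -muN le_measure ?inE//.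
  exact: measurableI.
(* The blocks miss only the origin and [N]. *)
have E_null : mu (~` \bigcup_k E k) = 0%E.
  pose Z : set (Rn R n) := [set x | enorm x = 0].
  have mZ : measurable Z.
    have := @measurable_enorm R n measurableT [set 0] (measurable_set1 0).
    by rewrite setTI.
  have muZ : mu Z = 0%E by exact: lebesgueRn_enorm0.
  have -> : ~` (\bigcup_k E k) = Z `|` N.
    rewrite /E -setI_bigcupl Ur setCI setCK; congr (_ `|` _).
    by apply/seteqP; split => x /=; [move/negP/negPn/eqP|move=> /eqP ->].
  exact: etrans (measureU0 mZ mN muN) muZ.
have hE k x : E k x -> 0 < h x.
  by move=> [_ /eqP hx]; rewrite lt_neqAle eq_sym hx h0.
have foo' : (\int[mu]_x epow (f x) q' < +oo)%E.
  by move: foo; under eq_integral do rewrite ger0_norm//.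
have muE_bnd k : ((m * r k ^+ n)%:E <= mu (E k) < +oo)%E.
  by rewrite muE lebesgueRn_annulus_ge// lebesgueRn_annulus_fin.
apply: (double_integral_blocks_ge mu n E r _ f h p q p' q' m c g hqp hp hp' hq'
  hg m0 c0 r0 mE tE E_null muE_bnd mf mh f0 h0 hE foo' hB).
- by move=> x y; rewrite !mule_ge0 ?epow_ge0 ?lee_fin.
- by move=> k x y [xk _] [yk _]; exact: kernel_ge.
Qed.
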